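(* Let $E$ be a real Banach space and $D\subset E^*$ a norming linear subspace. Then the following two conditions are equivalent: (i) $D$ is induced by a projectional skeleton in $E$. (ii) $D$ is weak$^*$ countably closed and $(E,\sigma(E,D))$ is monotonically Sokolov.
   Context: Banach spaces are over $\mathbb{R}$; all topological spaces are assumed to be Tychonoff. $B_{E^*}$ is the closed unit ball of $E^*$. A set $D\subset E^*$ is $r$-norming if $\|x\|\le r\cdot\sup\{|x^*(x)|: x^*\in D\cap B_{E^*}\}$ for all $x\in E$, and norming if it is $r$-norming for some $r\ge1$. $\sigma(E,D)$ is the weakest topology on $E$ making every functional in $D$ continuous. $D\subset E^*$ is weak$^*$ countably closed if the weak$^*$ closure of every countable subset of $D$ is contained in $D$. Projectional skeleton: a projectional skeleton in $E$ is a family $\{P_s\}_{s\in\Gamma}$ of bounded linear projections on $E$, indexed by an up-directed partially ordered set $\Gamma$, such that (1) $P_s[E]$ is separable for each $s\in\Gamma$; (2) $E=\bigcup_{s\in\Gamma}P_s[E]$; (3) if $s\le t$ in $\Gamma$ then $P_s=P_s\circ P_t=P_t\circ P_s$; (4) given $s_0<s_1<\cdots$ in $\Gamma$, $t=\sup_{n\in\omega}s_n$ exists in $\Gamma$ and $P_t[E]=\overline{\bigcup_{n\in\omega}P_{s_n}[E]}$. The subspace of $E^*$ induced by $\mathfrak{s}=\{P_s\}_{s\in\Gamma}$ is $D(\mathfrak{s})=\bigcup_{s\in\Gamma}P_s^*[E^*]$; $D$ is induced by a projectional skeleton if $D=D(\mathfrak{s})$ for some projectional skeleton $\mathfrak{s}$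 in $E$. Monotonically Sokolov: a space $T$ is monotonically Sokolov if one can assign to every countable family $\mathcal{F}$ of closed subsets of $T$ a continuous retraction $r_{\mathcal{F}}:T\to T$ (i.e. $r_{\mathcal{F}}\circ r_{\mathcal{F}}=r_{\mathcal{F}}$) and a countable external network $\mathcal{N}(\mathcal{F})$ of $r_{\mathcal{F}}(T)$ in $T$ such that $r_{\mathcal{F}}(F)\subset F$ for every $F\in\mathcal{F}$ and the assignment $\mathcal{N}$ is $\omega$-monotone. Here a family $\mathcal{N}$ of subsets of $T$ is an external network of $A\subset T$ in $T$ if for every $a\in A$ and every open $U\ni a$ there is $N\in\mathcal{N}$ with $a\in N\subset U$; and $\omega$-monotone means that $\mathcal{F}\subset\mathcal{G}$ implies $\mathcal{N}(\mathcal{F})\subset\mathcal{N}(\mathcal{G})$, and $\mathcal{N}(\bigcup_{n\in\omega}\mathcal{F}_n)=\bigcup_{n\in\omega}\mathcal{N}(\mathcal{F}_n)$ for every increasing sequence $(\mathcal{F}_n)_{n\in\omega}$ of countable families of closed subsets of $T$ (and all values of $\mathcal{N}$ are countable). *)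

(* Defs.v *)
From HB Require Import structures.
From mathcomp Require Import all_boot all_order all_algebra.
From mathcomp Require Import all_classical all_reals all_analysis.

Set Implicit Arguments.
Unset Strict Implicit.
Unset Printing Implicit Defensive.

Import Order.TTheory GRing.Theory Num.Theory.
Import numFieldNormedType.Exports.

Local Open Scope classical_set_scope.
Local Open Scope ring_scope.

Section Dual.
Context {R : realType} {E : normedModType R}.
Implicit Types (f : E -> R) (A D : set (E -> R)).

Definition dual : set (E -> R) := [set f : E -> R | scalar f /\ continuous f].

(* Operator norm; the supremum is a genuine one only when f is in the dual. *)
Definition dual_norm f : R := sup [set `|f x| | x in [set x : E | `|x| <= 1]].

Definition dual_ball : set (E -> R) := dual `&` [set f | dual_norm f <= 1].

Definition dual_subspace D : Prop :=
  [/\ D `<=` dual, D (fun=> 0) &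
      forall (a : R) f g, D f -> D g -> D (fun x => a * f x + g x)].

Definition r_norming (r : R) D : Prop :=
  forall x : E, `|x| <= r * sup [set `|f x| | f in D `&` dual_ball].

Definition norming D : Prop := exists2 r : R, 1 <= r & r_norming r D.

(* The weak* topology is the trace on the dual of the topology of pointwise
   convergence, so closures in it are traces of closures in {ptws E -> R}. *)
Definition weak_star_closure A : set (E -> R) :=
  dual `&` closure (A : set {ptws E -> R}).

Definition weak_star_countably_closed D : Prop :=
  forall A, countable A -> A `<=` D -> weak_star_closure A `<=` D.

(* sigma(E, D), carried by the type E *)
Definition sigma_topology D : topologicalType :=
  sup_topology (fun f : set_type D =>
    Topological.class (initial_topology (set_val f : E -> R))).

End Dual.

Arguments dual {R} E.
Arguments dual_ball {R} E.

Section ProjectionalSkeleton.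
Context {R : realType} {E : normedModType R}.

Definition separable_set (S : set E) : Prop :=
  exists2 A : set E, countable A & A `<=` S /\ S `<=` closure A.

(* Nonemptiness of the index set follows from skeleton_cover. *)
Record projectional_skeleton d (G : porderType d) (P : G -> {linear E -> E}) :
    Prop := {
  skeleton_directed : forall s t : G, exists u : G, (s <= u)%O /\ (t <= u)%O;
  skeleton_bounded : forall s, bounded_near (P s) (nbhs (0 : E));
  skeleton_projection : forall s, P s \o P s = P s :> (E -> E);
  skeleton_separable : forall s, separable_set (range (P s));
  skeleton_cover : [set: E] = \bigcup_(s in [set: G]) range (P s);
  skeleton_compatible : forall s t : G, (s <= t)%O ->
    P s = P s \o P t :> (E -> E) /\ P s = P t \o P s :> (E -> E);
  skeleton_sup : forall s : nat -> G, (forall n, (s n < s n.+1)%O) ->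
    exists2 t : G, supremums (range s) t &
      range (P t) = closure (\bigcup_n range (P (s n))) }.

Definition skeleton_dual d (G : porderType d) (P : G -> {linear E -> E}) :
    set (E -> R) :=
  \bigcup_(s in [set: G]) [set f \o P s | f in dual E].

Definition induced_by_projectional_skeleton (D : set (E -> R)) : Prop :=
  exists (d : Order.disp_t) (G : porderType d) (P : G -> {linear E -> E}),
    projectional_skeleton P /\ D = skeleton_dual P.

End ProjectionalSkeleton.

Section MonotonicallySokolov.
Variable T : topologicalType.
Implicit Types (F G N : set (set T)).

Definition countable_closed_family F : Prop :=
  countable F /\ forall C, F C -> closed C.

Definition external_network N (A : set T) : Prop :=
  forall a, A a -> forall U, open U -> U a ->
    exists B, [/\ N B, B a & B `<=` U].

(* The assignment N only matters on countable families of closed sets. *)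
Definition omega_monotone (N : set (set T) -> set (set T)) : Prop :=
  [/\ forall F, countable_closed_family F -> countable (N F),
      forall F G, countable_closed_family F -> countable_closed_family G ->
        F `<=` G -> N F `<=` N G &
      forall F : nat -> set (set T),
        (forall n, countable_closed_family (F n)) ->
        (forall n, F n `<=` F n.+1) ->
        N (\bigcup_n F n) = \bigcup_n N (F n)].

(* Spaces are not required to be Tychonoff: sigma(E, D) always is completely
   regular, and it is Hausdorff as soon as D is norming. *)
Definition monotonically_Sokolov : Prop :=
  exists (r : set (set T) -> T -> T) (N : set (set T) -> set (set T)),
    omega_monotone N /\
    forall F, countable_closed_family F ->
      [/\ continuous (r F), r F \o r F = r F,
          external_network (N F) (range (r F)) &
          forall C, F C -> r F @` C `<=` C].

End MonotonicallySokolov.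

(* Main.v *)
From HB Require Import structures.
Require Import Defs.
From mathcomp Require Import all_boot all_order all_algebra.
From mathcomp Require Import all_classical all_reals all_analysis.
From mathcomp Require Import ring lra.
Import Order.TTheory GRing.Theory Num.Theory.
Import numFieldNormedType.Exports.
Local Open Scope classical_set_scope.
Local Open Scope ring_scope.

(** Both implications rest on hulls: closing a countable set under countably many
    finitary operations gives a countable set, and hulls commute with increasing
    unions ([countable_hull], [hull_bigcup]).  The second property makes an
    assignment omega-monotone in one direction, and provides suprema of
    increasing sequences of indices in the other.

    From a skeleton [P] to a Sokolov assignment.  A countable subset of [D] is
    fixed by a single projection, and [f \o P t = f] is preserved by pointwise
    limits, so [D] is weak* countably closed.  To a countable family [F] of
    closed sets is attached a countable directed set of indices, with supremum
    [t]; the retraction is [P t] and the network consists of norm balls around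
    countable dense subsets of the ranges.  To have [P t] map [C] in [F] into
    itself, the indices are closed under the following choice: whenever some
    finite list of functionals of [D], bounded by [m], separates a point [q] from
    [C] with margin [1 / (k + 1)], one such list is fixed by some [P s] with [s]
    among the indices.  If [x] is in [C] and [P t x] is not, then a list of
    functionals separates [P t x], and hence a nearby [q], from [C]; a chosen
    list fixed by [P t] does so too; but its functionals agree at [x] and at
    [P t x], so that [x] is separated from [C], which is absurd
    ([skeleton_dual_Sokolov]).

    From a Sokolov assignment to a skeleton.  A model is a countable set of
    vectors [EM] together with a countable set of functionals [DM] of [D], closed
    under rational combinations, under the choice of norming functionals, and
    under the choice of points in the networks attached to rational half-spaces
    of functionals in [DM].  The key fact is that [E] is the direct sum of
    [closure EM] and of the annihilator of [DM] ([model_projection]).  The sum is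
    direct and closed because [DM] norms [EM].  If it were not dense, Hahn-Banach
    would give a nonzero [phi] vanishing on both summands; a bipolar argument puts
    [phi] in the weak* closure of [DM], hence in [D].  Let [r] be the retraction
    for the half-spaces of [DM].  It satisfies [f \o r = f] for [f] in [DM], so
    [r x - x] is in the annihilator and [phi (r x) = phi x]; when this value is
    nonzero, the network at [r x] yields a point of [EM] where [phi] does not
    vanish, a contradiction.  The resulting projections, indexed by models under
    inclusion, form a skeleton, and a continuous functional is fixed by one of
    them exactly when it belongs to [D]. *)

Set Implicit Arguments.
Unset Strict Implicit.
Unset Printing Implicit Defensive.

(** * Initial topologies for families of functionals *)

Section WeakTopology.
Context {R : realType} {T I : choiceType} (phi : I -> T -> R).

Definition weak_topology : topologicalType :=
  sup_topology (fun i => Topological.class (initial_topology (phi i))).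

(** The neighbourhood filter of [p] in the initial topology for the family
    [phi], described by finitely many coordinates and one radius.  Both
    [sigma_topology] and pointwise convergence are such initial topologies, and
    every topological argument below goes through this description. *)
Definition weak_filter (p : T) : set_system T :=
  [set U | exists2 e : R, 0 < e & exists l : seq I,
    forall q, (forall i, i \in l -> `|phi i q - phi i p| < e) -> U q].

Lemma weak_filter_filter p : Filter (weak_filter p).
Proof.
split.
- by exists 1 => //; exists [::].
- move=> U V [e e0 [l lU]] [d d0 [k kV]].
  exists (Num.min e d); first by rewrite lt_min e0.
  exists (l ++ k) => q lq; split.
  + apply: lU => i il; have := lq i; rewrite mem_cat il => /(_ isT).
    by rewrite lt_min => /andP[].
  + apply: kV => i ik; have := lq i; rewrite mem_cat ik orbT => /(_ isT).
    by rewrite lt_min => /andP[].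
- move=> U V UV [e e0 [l lU]]; exists e => //; exists l => q /lU; exact: UV.
Qed.

Lemma coordinate_continuous i : continuous (phi i : weak_topology -> R).
Proof.
move=> p; have /cvg_sup/(_ i) cp : nbhs (p : weak_topology) --> (p : weak_topology).
  exact: cvg_id.
move=> A fpA; apply: cp.
exact: (@initial_continuous _ _ (phi i) p).
Qed.

Lemma nbhs_weak (p : T) : nbhs (p : weak_topology) = weak_filter p.
Proof.
apply/seteqP; split.
  have := weak_filter_filter p => wF.
  suff : weak_filter p --> (p : weak_topology) by [].
  apply/cvg_sup => i U.
  rewrite /= (@nbhsE (initial_topology (phi i))) => -[_ [[B oB <-] Bp]].
  move=> /filterS; apply.
  have /nbhs_ballP[e e0 eB] : nbhs (phi i p) B by exact: open_nbhs_nbhs.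
  exists e => //; exists [:: i] => q /(_ i (mem_head _ _)) qi.
  by apply: eB; rewrite -ball_normE /ball_ /= distrC.
move=> U [e e0 [l lU]].
have : \forall q \near (p : weak_topology), forall i, i \in l -> `|phi i q - phi i p| < e.
  elim: {lU}l => [|i l IH]; first by near=> q.
  have ci : \forall q \near (p : weak_topology), `|phi i q - phi i p| < e.
    have /cvgrPdist_lt/(_ e e0) := @coordinate_continuous i p.
    by apply: filterS => q; rewrite distrC.
  near=> q => j; rewrite inE => /orP[/eqP ->|jl]; first by near: q.
  by move: j jl; near: q.
by apply: filterS => q; exact: lU.
Unshelve. all: by end_near. Qed.

End WeakTopology.

Section Instances.
Context {R : realType} {E : normedModType R}.

Lemma nbhs_sigma (D : set (E -> R)) (p : E) (U : set E) :
  nbhs (p : sigma_topology D) U <->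
  exists2 e : R, 0 < e & exists l : seq (E -> R), [set` l] `<=` D /\
    forall q, (forall f, f \in l -> `|f q - f p| < e) -> U q.
Proof.
rewrite (@nbhs_weak _ _ _ (fun f : set_type D => set_val f : E -> R)).
split=> [[e e0 [l lU]]|[e e0 [l [lD lU]]]]; exists e => //.
  exists (map val l); split=> [f /mapP[g _ ->]|q lq]; first exact: set_valP.
  by apply: lU => f fl; apply: lq; exact: map_f.
exists (pmap insub l) => q lq; apply: lU => f fl.
have fD : f \in D by apply/mem_set/lD.
by apply: (lq (SigSub fD)); rewrite mem_pmap_sub.
Qed.

Lemma nbhs_ptws (f : E -> R) (U : set (E -> R)) :
  nbhs (f : {ptws E -> R}) U <->
  exists2 e : R, 0 < e & exists l : seq E,
    forall g, (forall x, x \in l -> `|g x - f x| < e) -> U g.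
Proof.
have -> : nbhs (f : {ptws E -> R}) = weak_filter (fun x (g : E -> R) => g x) f.
  by rewrite -nbhs_weak.
by [].
Qed.

End Instances.

(** * Hulls under finitary operations *)

Lemma countable_setU (T : Type) (A B : set T) :
  countable A -> countable B -> countable (A `|` B).
Proof.
by move=> cA cB; rewrite -bigcup2E; apply: bigcup_countable => // -[|[|i]] _ /=.
Qed.

Lemma countable_enum (T : Type) (A : set T) : countable A -> A !=set0 ->
  exists h : nat -> T, range h = A.
Proof.
move=> /countable_injP[f finj] [a Aa].
have /choice[h hP] n : exists b, A b /\ ((exists2 c, A c & f c = n) -> f b = n).
  have [[c Ac fc]|nc] := pselect (exists2 c, A c & f c = n); first by exists c.
  by exists a; split=> // /nc.
exists h; apply/seteqP; split=> [_ [n _ <-]|b Ab]; first by case: (hP n).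
exists (f b) => //; have [Ahb fb] := hP (f b).
by apply: finj; [exact: mem_set|exact: mem_set|apply: fb; exists b].
Qed.

Section Hull.
Context {U : choiceType} (op : seq U -> set U).

(** One multivalued operation on finite sequences encodes any countable family
    of finitary operations: [op s] collects all their values on the entries of
    [s]. *)
Definition op_closed (A : set U) := forall s, [set` s] `<=` A -> op s `<=` A.

Definition hull (B : set U) : set U := smallest op_closed B.

Lemma hull_closed B : op_closed (hull B).
Proof.
by move=> s sB u us A [cA BA]; apply: (cA s) us => v /sB; apply.
Qed.

Lemma sub_hull B : B `<=` hull B.
Proof. exact: sub_gen_smallest. Qed.

Lemma hull_min A B : op_closed A -> B `<=` A -> hull B `<=` A.
Proof. exact: smallest_sub. Qed.

Lemma hullS A B : A `<=` B -> hull A `<=` hull B.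
Proof. move=> AB; apply: hull_min; first exact: hull_closed.
exact: subset_trans AB (@sub_hull B). Qed.

Lemma nondecreasing_sets (A : nat -> set U) :
  (forall n, A n `<=` A n.+1) -> forall m n, (m <= n)%N -> A m `<=` A n.
Proof.
move=> AS m n /subnK <-; elim: (n - m)%N => [//|k IH].
by apply: subset_trans IH _; rewrite addSn; exact: AS.
Qed.

Lemma seq_in_bigcup (A : nat -> set U) (s : seq U) :
  (forall n, A n `<=` A n.+1) -> [set` s] `<=` \bigcup_n A n ->
  exists n, [set` s] `<=` A n.
Proof.
move=> /nondecreasing_sets AS; elim: s => [|u s IH] us; first by exists 0%N.
have [n sn] : exists n, [set` s] `<=` A n.
  by apply: IH => v vs; apply: us; rewrite /= inE vs orbT.
have [m _ um] := us u (mem_head _ _).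
exists (maxn m n) => v; rewrite /= inE => /orP[/eqP->|vs].
  exact: AS (leq_maxl _ _) _ um.
exact: AS (leq_maxr _ _) _ (sn _ vs).
Qed.

(** The operation is finitary, so its arguments already lie in one member of an
    increasing sequence. *)
Lemma op_closed_bigcup (A : nat -> set U) :
  (forall n, A n `<=` A n.+1) -> (forall n, op_closed (A n)) ->
  op_closed (\bigcup_n A n).
Proof.
move=> AS cA s /seq_in_bigcup [//|n sn] u us.
by exists n => //; exact: cA sn _ us.
Qed.

(** Networks indexed by a hull are therefore omega-monotone. *)
Lemma hull_bigcup (B : nat -> set U) : (forall n, B n `<=` B n.+1) ->
  hull (\bigcup_n B n) = \bigcup_n hull (B n).
Proof.
move=> BS; apply/seteqP; split; last first.
  by move=> u [n _]; apply: hullS => v vB; exists n.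
apply: hull_min; last by move=> u [n _ /sub_hull uB]; exists n.
by apply: op_closed_bigcup => n; [exact: hullS|exact: hull_closed].
Qed.

Lemma countable_seqs (A : set U) :
  countable A -> countable [set s : seq U | [set` s] `<=` A].
Proof.
move=> /countable_injP[f finj]; apply/countable_injP.
exists (pickle \o map f) => s t /set_mem sA /set_mem tA /=.
move=> /(pcan_inj pickleK); elim: s t sA tA => [|u s IH] [|v t] //= uA vA [fuv fst].
congr (_ :: _); last first.
  apply: IH => // w ws; [apply: uA|apply: vA]; by rewrite /= inE ws orbT.
by apply: finj fuv; apply/mem_set; [apply: uA|apply: vA]; exact: mem_head.
Qed.

Lemma countable_hull B :
  (forall s, countable (op s)) -> countable B -> countable (hull B).
Proof.
move=> cop cB.
pose step A := A `|` \bigcup_(s in [set s : seq U | [set` s] `<=` A]) op s.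
have cstep n : countable (iter n step B).
  elim: n => [//|n IH]; rewrite iterS; apply: countable_setU => //.
  apply: bigcup_countable; first exact: countable_seqs IH.
  by move=> s _; exact: cop.
have stepS n : iter n step B `<=` iter n.+1 step B by move=> u Bu; left.
have cstages : countable (\bigcup_n iter n step B).
  by apply: bigcup_countable => // n _; exact: cstep.
suff sub : hull B `<=` \bigcup_n iter n step B.
  exact: sub_countable (subset_card_le sub) cstages.
apply: hull_min => [s /seq_in_bigcup[//|n sn] u us|u Bu]; last by exists 0%N.
by exists n.+1 => //; right; exists s.
Qed.

End Hull.

(** * The Hahn-Banach theorem *)

Section HahnBanach.
Context {R : realType} {V : lmodType R} (p : V -> R).
Hypothesis pD : forall x y, p (x + y) <= p x + p y.
Hypothesis pZ : forall a x, 0 <= a -> p (a *: x) = a * p x.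
Implicit Type G : set (V * R).

(** A partial linear functional is represented by its graph.  Domination by [p]
    forces a linear relation to be functional, because [p 0 = 0]; hence the
    graph needs no separate single-valuedness condition. *)
Definition dominated_relation G : Prop :=
  [/\ G (0, 0),
      forall a x s y t, G (x, s) -> G (y, t) -> G (a *: x + y, a * s + t) &
      forall x t, G (x, t) -> t <= p x].

Let extend G x0 c : set (V * R) :=
  [set u | exists x t b, G (x, t) /\ u = (x + b *: x0, t + b * c)].

(** The value [c] at [x0] must separate the numbers [t - p (x - x0)] from the
    numbers [p (y + x0) - s], for [(x, t)] and [(y, s)] in the graph; the
    supremum of the former does. *)
Let dominated_extend G x0 : dominated_relation G ->
  exists c, dominated_relation (extend G x0 c).
Proof.
move=> [G0 Glin Gp].
have p0 : p 0 = 0 by rewrite -(scale0r 0) pZ// mul0r.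
pose L := [set c | exists x t, G (x, t) /\ c = t - p (x - x0)].
have Lub y s : G (y, s) -> ubound L (p (y + x0) - s).
  move=> Gy c [x [t [Gx ->]]].
  have := Gp _ _ (Glin 1 _ _ _ _ Gx Gy); rewrite scale1r mul1r => xy.
  have : p (x + y) <= p (x - x0) + p (y + x0).
    by apply: le_trans (pD _ _); rewrite addrACA addNr addr0.
  lra.
have L0 : L !=set0 by exists (0 - p (0 - x0)), 0, 0.
have cub y s : G (y, s) -> sup L <= p (y + x0) - s.
  by move=> Gy; apply: ge_sup => //; exact: Lub.
have clb x t : G (x, t) -> t - p (x - x0) <= sup L.
  move=> Gx; apply: ub_le_sup; last by exists x, t.
  by exists (p (0 + x0) - 0); exact: Lub.
exists (sup L); split.
- by exists 0, 0, 0; split=> //; rewrite scale0r mul0r !addr0.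
- move=> a _ _ _ _ [x [s [b [Gx [-> ->]]]]] [y [t [d [Gy [-> ->]]]]].
  exists (a *: x + y), (a * s + t), (a * b + d); split; first exact: Glin.
  congr pair; last by ring.
  by rewrite scalerDr scalerDl scalerA addrACA.
- move=> _ _ [x [t [b [Gx [-> ->]]]]].
  have Gs a : G (a *: x, a * t).
    by have := Glin a _ _ _ _ Gx G0; rewrite !addr0.
  have [b0|b0|->] := ltgtP b 0.
  + have nb0 : 0 < - b by rewrite oppr_gt0.
    have /clb := Gs (- b)^-1; rewrite -(ler_pM2l nb0) mulrBr mulrA divff ?gt_eqF//.
    rewrite mul1r -(pZ _ (ltW nb0)) scalerBr scalerA divff ?gt_eqF//.
    rewrite scale1r scaleNr opprK.
    lra.
  + have /cub := Gs b^-1; rewrite -(ler_pM2l b0) mulrBr mulrA divff ?gt_eqF//.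
    rewrite mul1r -(pZ _ (ltW b0)) scalerDr scalerA divff ?gt_eqF// scale1r.
    lra.
  + by rewrite scale0r mul0r !addr0; exact: Gp.
Qed.

Lemma hahn_banach G0 : dominated_relation G0 ->
  exists2 f : V -> R, scalar f &
    (forall x, f x <= p x) /\ forall x t, G0 (x, t) -> f x = t.
Proof.
move=> dG0.
have p0 : p 0 = 0 by rewrite -(scale0r 0) pZ// mul0r.
(* Zorn's lemma is also applied to the empty chain, whose union is empty; hence
   the extensions of [G0] are encoded as unions [G0 `|` A]. *)
pose P A := dominated_relation (G0 `|` A).
have [|A [PA Amax]] := @Zorn_bigcup _ P.
  move=> F FP Ftot.
  have [[X0 FX0]|F0] := pselect (exists X, F X); last first.
    suff -> : \bigcup_(X in F) X = set0 by rewrite /P setU0.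
    by apply/seteqP; split=> // u [X FX _]; apply: F0; exists X.
  have common u v : (G0 `|` \bigcup_(X in F) X) u -> (G0 `|` \bigcup_(X in F) X) v ->
      exists2 X, F X & (G0 `|` X) u /\ (G0 `|` X) v.
    move=> [Gu|[X FX Xu]] [Gv|[Y FY Yv]].
    - by exists X0 => //; split; left.
    - by exists Y => //; split; [left|right].
    - by exists X => //; split; [right|left].
    - have [XY|YX] := Ftot _ _ FX FY.
        by exists Y => //; split; right => //; exact: XY.
      by exists X => //; split; right => //; exact: YX.
  split.
  - by left; case: dG0.
  - move=> a x s y t Hx Hy; have [X FX [Xx Xy]] := common _ _ Hx Hy.
    have [_ Xlin _] := FP _ FX.
    by have [|XX] := Xlin a _ _ _ _ Xx Xy; [left|right; exists X].
  - move=> x t Hx; have [X FX [Xx _]] := common _ _ Hx Hx.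
    by have [_ _] := FP _ FX; apply.
set G := G0 `|` A in PA *; have [Gz Glin Gp] := PA.
have Gtotal x : exists t, G (x, t).
  apply: contrapT => nx; have [c cP] := dominated_extend x PA.
  have sub : G `<=` extend G x c.
    by move=> [y t] Gy; exists y, t, 0; split=> //; rewrite scale0r mul0r !addr0.
  apply: (Amax (extend G x c)); last first.
    rewrite /P; suff -> : G0 `|` extend G x c = extend G x c by [].
    by apply/setUidPr => u G0u; apply: sub; left.
  split; first by move=> u Au; apply: sub; right.
  move=> /(_ (x, c)) xA; apply: nx; exists c; right; apply: xA.
  by exists 0, 0, 1; split=> //; rewrite scale1r mul1r !add0r.
have Gle x s t : G (x, s) -> G (x, t) -> t <= s.
  move=> Gs Gt; have := Gp _ _ (Glin (-1) _ _ _ _ Gs Gt).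
  by rewrite scaleN1r addNr p0 mulN1r addrC subr_le0.
have Guniq x s t : G (x, s) -> G (x, t) -> s = t.
  by move=> Gs Gt; apply/eqP; rewrite eq_le !(Gle x).
have [f fG] := choice Gtotal.
exists f.
  move=> a x y; apply: (Guniq (a *: x + y)); first exact: fG.
  by apply: Glin; exact: fG.
split=> [x|x t G0x]; first exact: Gp (fG x).
by apply: (Guniq x) => //; left.
Qed.

End HahnBanach.

(** * Continuous functionals *)

Section Functionals.
Context {R : realType} {E : normedModType R}.

Lemma bounded_functional_dual (f : E -> R) (C : R) :
  scalar f -> (forall x, `|f x| <= C * `|x|) -> dual E f.
Proof.
move=> flin fC; split=> // x; apply/cvgrPdist_lt => e e0.
have C0 : 0 < `|C| + 1 by rewrite ltr_wpDl.
near=> y.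
have -> : f x - f y = f (x - y).
  by rewrite addrC -mulN1r -flin scaleN1r addrC.
apply: (le_lt_trans (fC _)); apply: (@le_lt_trans _ _ ((`|C| + 1) * `|x - y|)).
  by rewrite ler_wpM2r// (le_trans (ler_norm C))// lerDl.
rewrite mulrC -ltr_pdivlMr//; near: y.
by apply: cvgr_dist_lt => //; rewrite divr_gt0.
Unshelve. all: by end_near. Qed.

(** Hahn-Banach extension of [x + t *: x0 |-> t], which is dominated by
    [d^-1 * `|.|] because [x0] has distance at least [d] to [S]. *)
Lemma dual_separates (S : set E) (x0 : E) (d : R) :
  S 0 -> (forall a x y, S x -> S y -> S (a *: x + y)) ->
  0 < d -> (forall x, S x -> d <= `|x0 - x|) ->
  exists2 f, dual E f & f x0 = 1 /\ forall x, S x -> f x = 0.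
Proof.
move=> S0 Slin d0 Sd.
pose p (x : E) := d^-1 * `|x|.
pose G0 := [set u : E * R | exists2 s, S s & u.1 = s + u.2 *: x0].
have [|||f flin [fp fG]] := @hahn_banach _ _ p _ _ G0.
- move=> x y; rewrite /p -mulrDr; apply: ler_wpM2l; last exact: ler_normD.
  by rewrite invr_ge0 ltW.
- by move=> a x a0; rewrite /p normrZ ger0_norm// mulrCA.
- split=> [|a _ s _ t [x Sx /= ->] [y Sy /= ->]|_ t [x Sx /= ->]].
  + by exists 0 => //=; rewrite scale0r addr0.
  + exists (a *: x + y); first exact: Slin.
    by rewrite /= scalerDr scalerDl scalerA addrACA.
  + rewrite /p ler_pdivlMl//; have [t0|t0] := leP t 0.
      by rewrite (le_trans _ (normr_ge0 _))// pmulr_rle0.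
    have : S (- t^-1 *: x + 0) by exact: Slin.
    move/Sd; rewrite addr0 scaleNr opprK => dx.
    have -> : x + t *: x0 = t *: (x0 + t^-1 *: x).
      by rewrite scalerDr scalerA divff ?gt_eqF// scale1r addrC.
    by rewrite normrZ gtr0_norm// mulrC ler_pM2l.
exists f.
  apply: (@bounded_functional_dual _ d^-1) => // x; rewrite ler_norml fp andbT.
  have := fp (- x); rewrite /p normrN lerNl; congr (_ <= _).
  have f0 : f 0 = 0 by apply: fG; exists 0 => //=; rewrite scale0r addr0.
  by have := flin (-1) x 0; rewrite addr0 scaleN1r mulN1r f0 addr0.
split=> [|x Sx]; apply: fG; first by exists 0 => //=; rewrite scale1r add0r.
by exists x => //=; rewrite scale0r addr0.
Qed.



Lemma dual_bounded (f : E -> R) : dual E f ->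
  exists m : nat, forall v, `|f v| <= m%:R * `|v|.
Proof.
move=> [flin fcont].
pose g : {linear E -> R^o} := HB.pack f (GRing.isLinear.Build R E R^o *:%R f flin).
have /linear_boundedP gb : bounded_near g (nbhs 0).
  by apply/linear_bounded_continuous.
have [r [_ rP]] := gb.
exists (Num.truncn `|r|).+1 => v; apply: rP.
by apply: le_lt_trans (ler_norm r) _; rewrite truncnS_gt.
Qed.

Lemma dual_seq_bounded (l : seq (E -> R)) : [set` l] `<=` dual E ->
  exists m : nat, forall f, f \in l -> forall v, `|f v| <= m%:R * `|v|.
Proof.
elim: l => [|f l IH] ld; first by exists 0%N.
have [m mP] : exists m : nat, forall f, f \in l -> forall v, `|f v| <= m%:R * `|v|.
  by apply: IH => g gl; apply: ld; rewrite /= inE gl orbT.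
have [k kP] := dual_bounded (ld _ (mem_head _ _)).
exists (maxn k m) => g; rewrite inE => /orP[/eqP ->|gl] v.
  by apply: (le_trans (kP v)); rewrite ler_wpM2r// ler_nat leq_maxl.
by apply: (le_trans (mP g gl v)); rewrite ler_wpM2r// ler_nat leq_maxr.
Qed.

Lemma dualB (f : E -> R) x y : dual E f -> f (x - y) = f x - f y.
Proof. by move=> [flin _]; rewrite addrC -scaleN1r flin mulN1r addrC. Qed.

Lemma dual0 (f : E -> R) : dual E f -> f 0 = 0.
Proof. by move=> fd; have := dualB 0 0 fd; rewrite !subrr. Qed.

Lemma nbhs_sigma_norm (D : set (E -> R)) (p : E) (U : set E) :
  D `<=` dual E -> nbhs (p : sigma_topology D) U -> nbhs p U.
Proof.
move=> Dd /nbhs_sigma[e e0 [l [lD lU]]].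
have : \forall q \near p, forall f, f \in l -> `|f q - f p| < e.
  elim: l lD {lU} => [|f l IH] lD; first by near=> q.
  have fp : \forall q \near p, `|f q - f p| < e.
    have [_ /(_ p)/cvgrPdist_lt/(_ e e0)] := Dd _ (lD _ (mem_head _ _)).
    by apply: filterS => q; rewrite distrC.
  have lp : \forall q \near p, forall g, g \in l -> `|g q - g p| < e.
    by apply: IH => g gl; apply: lD; rewrite /= inE gl orbT.
  near=> q => g; rewrite inE => /orP[/eqP ->|gl]; first by near: q.
  by move: g gl; near: q.
by apply: filterS => q; exact: lU.
Unshelve. all: by end_near. Qed.

Lemma dual_ball_bound (f : E -> R) :
  dual_ball E f -> forall v, `|f v| <= `|v|.
Proof.
move=> [fd f1] v; have [m mP] := dual_bounded fd.
have [->|v0] := eqVneq v 0.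
  by have := mP 0; rewrite normr0 mulr0.
have nv : 0 < `|v| by rewrite normr_gt0.
have : `|f (`|v|^-1 *: v)| <= dual_norm f.
  apply: ub_le_sup; last first.
    by exists (`|v|^-1 *: v) => //=; rewrite normrZ gtr0_norm ?invr_gt0// mulVf// gt_eqF.
  exists m%:R => _ [x /= x1 <-]; apply: le_trans (mP x) _.
  by rewrite -[leRHS]mulr1 ler_wpM2l.
have [flin _] := fd.
have f0 := dual0 fd.
have := flin (`|v|^-1) v 0; rewrite f0 !addr0 => -> /le_trans/(_ f1).
by rewrite normrM gtr0_norm ?invr_gt0// mulrC ler_pdivrMr// mul1r.
Qed.

(** The factor 2 makes room for a functional that need not attain the supremum
    in the definition of an [r]-norming set. *)
Lemma norming_functional (D : set (E -> R)) (r : R) :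
  D (fun=> 0) -> 1 <= r -> r_norming r D ->
  forall x : E, exists f, [/\ D f, forall v, `|f v| <= `|v| &
    `|x| <= r * 2 * `|f x|].
Proof.
move=> D0 r1 rD x; have [->|x0] := eqVneq x 0.
  by exists (fun=> 0); split=> // [v|]; rewrite !normr0 ?mulr0.
have nx : 0 < `|x| by rewrite normr_gt0.
have r0 : 0 < r by rewrite (lt_le_trans _ r1).
have := rD x; set S := [set _ | _ in _] => xS.
have supS : `|x| / r / 2 < sup S.
  apply: (@lt_le_trans _ _ (`|x| / r)); last by rewrite ler_pdivrMr// mulrC.
  by rewrite ltr_pdivrMr// ltr_pMr ?ltr1n// divr_gt0.
have S0 : S !=set0.
  apply/set0P/negP => /eqP S0; move: supS; rewrite S0 sup0 ltNge.
  by rewrite !divr_ge0// ltW.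
have [_ [f [Df fb] <-] fx] := sup_gt S0 supS.
exists f; split=> //; first exact: dual_ball_bound.
by move: fx; rewrite !ltr_pdivrMr// => fx; lra.
Qed.

End Functionals.

(** * From a projectional skeleton to the Sokolov property *)

Lemma double_inv_lt (R : realType) (e : R) : 0 < e ->
  exists k : nat, k.+1%:R^-1 + k.+1%:R^-1 < e.
Proof.
move=> e0; exists (Num.truncn (2 / e)); set K : R := _.+1%:R.
have : 2 / e < K by exact: truncnS_gt.
by rewrite ltr_pdivrMr// => Ke; rewrite -mulr2n -mulr_natl ltr_pdivrMr// mulrC.
Qed.

Section SkeletonToSokolov.
Context {R : realType} {E : normedModType R} {d : Order.disp_t}
  {G : porderType d} (P : G -> {linear E -> E}).
Hypothesis skP : projectional_skeleton P.
Let D := skeleton_dual P.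
Hypothesis Ddual : D `<=` dual E.

Let P_continuous s : continuous (P s).
Proof. by apply: bounded_linear_continuous; exact: skeleton_bounded skP s. Qed.

Let P_fix s x : range (P s) x -> P s x = x.
Proof.
by move=> [y _ <-]; have /(congr1 (fun f => f y)) := skeleton_projection skP s.
Qed.

Let P_le s t : (s <= t)%O -> forall x, P s x = P s (P t x).
Proof.
by move=> st x; have [/(congr1 (fun f => f x))] := skeleton_compatible skP st.
Qed.

Let P_ge s t : (s <= t)%O -> forall x, P s x = P t (P s x).
Proof.
by move=> st x; have [_ /(congr1 (fun f => f x))] := skeleton_compatible skP st.
Qed.

Let range_le s t : (s <= t)%O -> range (P s) `<=` range (P t).
Proof. by move=> st _ [x _ <-]; exists (P s x) => //; rewrite -P_ge. Qed.

Let range_closed s : closed (range (P s)).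
Proof.
have -> : range (P s) = (fun x => P s x - x) @^-1` [set 0].
  apply/seteqP; split=> x /=; first by move=> /P_fix ->; rewrite subrr.
  by move=> /eqP; rewrite subr_eq0 => /eqP Px; exists x.
apply: (@preimage_closed E E) => [x _|].
  by apply: cvgB; [exact: P_continuous|exact: cvg_id].
exact/accessible_closed_set1/hausdorff_accessible/norm_hausdorff.
Qed.

(** Suprema are only given for strictly increasing sequences.  A countable
    directed set without a greatest element has a strictly increasing cofinal
    sequence; otherwise the greatest element is the supremum, and the range of
    its projection is closed. *)
Lemma countable_directed_sup (H : set G) : countable H -> H !=set0 ->
  (forall s t, H s -> H t -> exists2 u, H u & (s <= u)%O /\ (t <= u)%O) ->
  exists2 t, (forall s, H s -> (s <= t)%O) &
    range (P t) = closure (\bigcup_(s in H) range (P s)).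
Proof.
move=> cH H0 dH.
have [[m Hm mmax]|nomax] := pselect (exists2 m, H m & forall s, H s -> (s <= m)%O).
  exists m => //; apply/seteqP; split.
    by move=> x xm; apply: subset_closure; exists m.
  rewrite [X in _ `<=` X]((closure_id _).1 (@range_closed m)).
  by apply: closureS; apply: bigcup_sub => s Hs; exact/range_le/mmax.
have [h hH] := countable_enum cH H0.
have Hh n : H (h n) by rewrite -hH; exists n.
have /choice[next nextP] (sn : G * nat) : exists u, H sn.1 ->
    [/\ H u, (sn.1 < u)%O & (h sn.2 <= u)%O].
  case: sn => s n /=; have [Hs|nHs] := pselect (H s); last by exists s.
  have [v Hv nvs] : exists2 v, H v & ~ (v <= s)%O.
    apply: contrapT => nv; apply: nomax; exists s => // v Hv.
    by apply: contrapT => nvs; apply: nv; exists v.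
  have [u Hu [su vu]] := dH _ _ Hs Hv.
  have [w Hw [uw hw]] := dH _ _ Hu (Hh n).
  exists w => _; split=> //; rewrite lt_neqAle (le_trans su uw) andbT.
  by apply/eqP => sw; apply: nvs; rewrite sw (le_trans vu uw).
pose t := fix t n := if n is m.+1 then next (t m, m) else h 0%N.
have Ht n : H (t n) by elim: n => [|n /(nextP (t n, n))[]] //=; exact: Hh.
have tS n : (t n < t n.+1)%O by have [] := nextP (t n, n) (Ht n).
have ht n : (h n <= t n.+1)%O by have [] := nextP (t n, n) (Ht n).
have [s [sub _] rs] := skeleton_sup skP tS.
have ts n : (t n <= s)%O by apply: sub; exists n.
exists s => [g|].
  by rewrite -{1}hH => -[n _ <-]; exact: le_trans (ht n) (ts n.+1).
rewrite rs; apply/seteqP; split; apply: closureS; apply: bigcup_sub.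
  by move=> n _ x tx; exists (t n) => //; exact: Ht.
move=> g; rewrite -{1}hH => -[n _ <-] x hx.
by exists n.+1 => //; exact: range_le (ht n) _ hx.
Qed.

Let upper_bound_seq : exists ub : seq G -> G,
  forall l s, s \in l -> (s <= ub l)%O.
Proof.
suff /choice[ub ubP] (l : seq G) : exists u, forall s, s \in l -> (s <= u)%O.
  by exists ub.
elim: l => [|s l [u uP]].
  have : [set: E] 0 by []; rewrite (skeleton_cover skP) => -[g _ _].
  by exists g.
have [v [sv uv]] := skeleton_directed skP s u.
exists v => w; rewrite inE => /orP[/eqP ->//|/uP wu]; exact: le_trans wu uv.
Qed.

(** A functional of [D] is determined by some [P s], and then by every later
    projection. *)
Let skeleton_dual_fixed f : D f -> exists s, forall t, (s <= t)%O -> f \o P t = f.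
Proof.
move=> [s _ [g _ <-]]; exists s => t st; apply/funext => x /=.
by rewrite -P_le.
Qed.

(** A single projection [P t] fixes all members of a countable subset of [D],
    and the equation [f \o P t = f] passes to pointwise limits. *)
Lemma skeleton_dual_countably_closed : weak_star_countably_closed D.
Proof.
move=> A cA AD f [fd fA].
have /choice[s sP] g : exists s, A g -> forall t, (s <= t)%O -> g \o P t = g.
  have [/AD/skeleton_dual_fixed[s sP]|nA] := pselect (A g); first by exists s.
  by have [ub _] := upper_bound_seq; exists (ub [::]).
have [ub ubP] := upper_bound_seq.
pose op (l : seq G) := [set ub l].
pose H := hull op (s @` A).
have [g0 [Ag0 _]] : A `&` [set: E -> R] !=set0.
  by apply: fA; exact: (@filterT _ (nbhs (f : {ptws E -> R}))).
have cH : countable H.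
  apply: countable_hull => [l|]; first exact: countable1.
  exact: sub_countable (card_image_le _ _) cA.
have H0 : H !=set0 by exists (s g0); apply: sub_hull; exists g0.
have dH u v : H u -> H v -> exists2 w, H w & (u <= w)%O /\ (v <= w)%O.
  move=> Hu Hv; exists (ub [:: u; v]).
    apply: (@hull_closed _ op _ [:: u; v]) => // w.
    by rewrite /= !inE => /orP[] /eqP ->.
  by split; apply: ubP; rewrite !inE eqxx ?orbT.
have [t tP _] := countable_directed_sup cH H0 dH.
suff fP : f \o P t = f by exists t => //; exists f.
apply/funext => x /=; apply: contrapT => /eqP; rewrite -subr_eq0 => fx.
pose e := `|f (P t x) - f x| / 2.
have e0 : 0 < e by rewrite divr_gt0 ?normr_gt0.
have : nbhs (f : {ptws E -> R})
    [set g | `|g x - f x| < e /\ `|g (P t x) - f (P t x)| < e].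
  apply/nbhs_ptws; exists e => //; exists [:: x; P t x] => g gl.
  by split; apply: gl; rewrite !inE eqxx ?orbT.
move=> /fA[g [Ag [gx gPx]]].
have gP : g (P t x) = g x.
  have st : (s g <= t)%O by apply: tP; apply: sub_hull; exists g.
  by have /(congr1 (fun h => h x)) := sP g Ag t st.
have : `|f (P t x) - f x| < e + e.
  rewrite -(subrK (g x) (f (P t x))) -addrA (le_lt_trans (ler_normD _ _))//.
  by rewrite ltrD// -gP distrC.
by rewrite /e -splitr ltxx.
Qed.

Let separable_choice : exists Q : G -> set E, forall s,
  countable (Q s) /\ range (P s) `<=` closure (Q s).
Proof.
suff /choice[Q QP] s : exists Q, countable Q /\ range (P s) `<=` closure Q.
  by exists Q.
by have [A cA [_ sA]] := skeleton_separable skP s; exists A.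
Qed.

(** The functionals in [l] define a neighbourhood of [q] disjoint from [C].  The
    parameters [C], [q], [m], [k] range over a countable set as soon as [C] and
    [q] do, so that witnesses [l] can be collected in a countable hull. *)
Definition avoids (C : set E) (q : E) (m k : nat) (l : seq (E -> R)) : Prop :=
  [/\ [set` l] `<=` D, forall f, f \in l -> forall v, `|f v| <= m%:R * `|v| &
      forall y, C y -> ~ forall f, f \in l -> `|f y - f q| < k.+1%:R^-1].

(** The index chosen for [(C, q, m, k)] is large enough for its projection to
    fix a whole witness [l]. *)
Let witness_choice : exists w : set E * E * nat * nat -> G,
  forall C q m k, (exists l, avoids C q m k l) ->
  exists2 l, avoids C q m k l & forall f, f \in l -> f \o P (w (C, q, m, k)) = f.
Proof.
have [ub ubP] := upper_bound_seq.
have /choice[w wP] (a : set E * E * nat * nat) : exists w,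
  (exists l, avoids a.1.1.1 a.1.1.2 a.1.2 a.2 l) ->
  exists2 l, avoids a.1.1.1 a.1.1.2 a.1.2 a.2 l & forall f, f \in l -> f \o P w = f.
  case: a => [[[C q] m] k] /=.
  have [[l Al]|nl] := pselect (exists l, avoids C q m k l); last by exists (ub [::]).
  have [lD _ _] := Al.
  suff [w wl] : exists w, forall t, (w <= t)%O -> forall f, f \in l -> f \o P t = f.
    by exists w => _; exists l => //; exact: wl.
  elim: l lD {Al} => [|f l IH] lD; first by exists (ub [::]).
  have [w wl] : exists w, forall t, (w <= t)%O -> forall f, f \in l -> f \o P t = f.
    by apply: IH => g gl; apply: lD; rewrite /= inE gl orbT.
  have [s sf] := skeleton_dual_fixed (lD _ (mem_head _ _)).
  have [u [wu su]] := skeleton_directed skP w s.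
  exists u => t ut g; rewrite inE => /orP[/eqP ->|gl].
    by apply: sf; exact: le_trans su ut.
  by apply: wl => //; exact: le_trans wu ut.
by exists w => C q m k; exact: (wP (C, q, m, k)).
Qed.

(** For a countable family [F] the indices [H F] form a countable directed set
    closed under the choice of witnesses for members of [F]; [P (t F)], where
    [t F] is the supremum of [H F], is the retraction, and the network consists
    of the balls with centres in the countable dense sets [Q s], for [s] in
    [H F].  If [P (t F)] moved a point [x] of [C] outside [C], a basic
    neighbourhood of [P (t F) x] would avoid [C]; this survives a small change
    of the centre to some [q] in [Q s], hence is witnessed by functionals which
    [P (t F)] fixes, and these do not distinguish [x] from [P (t F) x]. *)
Lemma skeleton_dual_Sokolov : monotonically_Sokolov (sigma_topology D).
Proof.
have [ub ubP] := upper_bound_seq.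
have [Q QP] := separable_choice.
have [w wP] := witness_choice.
(* The hull lives on pairs of an index and a set, so that one operation can
   combine indices with members of [F]; the empty set is a dummy second
   component, and [ub [::]] a dummy first one. *)
pose op (s : seq (G * set E)) : set (G * set E) :=
  [set (ub (map fst s), set0)] `|`
  \bigcup_(u in [set` s]) \bigcup_(v in [set` s]) \bigcup_(q in Q v.1)
    range (fun mk : nat * nat => (w (u.2, q, mk.1, mk.2), set0)).
have cop s : countable (op s).
  apply: countable_setU; first exact: countable1.
  have cs : countable [set` s] by exact: finite_set_countable.
  apply: bigcup_countable => // u _; apply: bigcup_countable => // v _.
  apply: bigcup_countable => [|q _]; first by case: (QP v.1).
  exact: sub_countable (card_image_le _ _) (countableP _).
pose base (F : set (set E)) : set (G * set E) :=
  (fun C => (ub [::], C)) @` (F `|` [set set0]).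
pose H F := fst @` hull op (base F).
have cH F : countable F -> countable (H F).
  move=> cF; apply: sub_countable (card_image_le _ _) _; apply: countable_hull => //.
  apply: sub_countable (card_image_le _ _) _.
  by apply: countable_setU => //; exact: countable1.
have H0 F : H F !=set0.
  by exists (ub [::]), (ub [::], set0) => //; apply: sub_hull; exists set0 => //; right.
have dH F s t : H F s -> H F t -> exists2 u, H F u & (s <= u)%O /\ (t <= u)%O.
  move=> [u Hu <-] [v Hv <-]; exists (ub [:: u.1; v.1]).
    exists (ub [:: u.1; v.1], set0) => //.
    apply: (@hull_closed _ op _ [:: u; v]); last by left.
    by move=> x; rewrite /= !inE => /orP[] /eqP ->.
  by split; apply: ubP; rewrite !inE eqxx ?orbT.
have HW F C s q m k : F C -> H F s -> Q s q -> H F (w (C, q, m, k)).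
  move=> FC [v Hv <-] Qq; exists (w (C, q, m, k), set0) => //.
  apply: (@hull_closed _ op _ [:: (ub [::], C); v]).
    move=> x; rewrite /= !inE => /orP[] /eqP -> //.
    by apply: sub_hull; exists C => //; left.
  right; exists (ub [::], C); first exact: mem_head.
  exists v; first by rewrite /= !inE eqxx orbT.
  by exists q => //; exists (m, k).
have HS A B : A `<=` B -> H A `<=` H B.
  move=> AB; apply: image_subset; apply: hullS; apply: image_subset.
  exact: setSU.
have Hbigcup (F : nat -> set (set E)) : (forall n, F n `<=` F n.+1) ->
    H (\bigcup_n F n) = \bigcup_n H (F n).
  move=> FS; rewrite /H -image_bigcup -hull_bigcup; last first.
    by move=> n; apply: image_subset; exact: setSU.
  congr (fst @` hull op _); rewrite /base -image_bigcup; congr (_ @` _).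
  apply/seteqP; split=> [C [[n _ FC]|C0]|C [n _ [FC|C0]]].
  - by exists n => //; left.
  - by exists 0%N => //; right.
  - by left; exists n.
  - by right.
have /choice[t tP] F : exists t, countable F ->
    (forall s, H F s -> (s <= t)%O) /\
    range (P t) = closure (\bigcup_(s in H F) range (P s)).
  have [cF|ncF] := pselect (countable F); last by exists (ub [::]).
  by have [t] := countable_directed_sup (cH _ cF) (H0 F) (dH F); exists t.
pose N F : set (set E) := \bigcup_(s in H F) \bigcup_(q in Q s)
  range (fun k : nat => ball q k.+1%:R^-1).
exists (fun F => P (t F)), N; split.
  split=> [F [cF _]|A B _ _ AB|F cF FS].
  - apply: bigcup_countable => [|s _]; first exact: cH.
    apply: bigcup_countable => [|q _]; first by case: (QP s).
    exact: sub_countable (card_image_le _ _) (countableP _).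
  - by apply: bigcup_subset; exact: HS.
  - by rewrite /N Hbigcup// bigcup_bigcup.
move=> F [cF clF]; have [tH rt] := tP F cF; split.
- move=> p U /nbhs_sigma[e e0 [l [lD lU]]]; apply/nbhs_sigma.
  exists e => //; exists (map (fun f => f \o P (t F)) l); split.
    move=> _ /mapP[f fl ->]; exists (t F) => //; exists f => //.
    exact/Ddual/lD.
  by move=> q lq; apply: lU => f fl; apply: (lq (f \o P (t F))); exact: map_f.
- exact: skeleton_projection skP _.
- move=> a; rewrite rt => ra U oU Ua.
  have /nbhs_ballP[e e0 eU] : nbhs (a : E) U.
    by apply: (nbhs_sigma_norm Ddual); exact: open_nbhs_nbhs.
  have [k ke] := double_inv_lt e0.
  have k0 : 0 < (k.+1%:R^-1 / 2 : R) by rewrite divr_gt0// invr_gt0.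
  have [x [[s Hs sx] /= ax]] := ra _ (nbhsx_ballx a _ k0).
  have [_ /(_ x sx)] := QP s; move=> /(_ _ (nbhsx_ballx x _ k0))[q [Qq /= xq]].
  have aq : ball a k.+1%:R^-1 q by rewrite (splitr k.+1%:R^-1);
    exact: ball_triangle ax xq.
  exists (ball q k.+1%:R^-1); split.
  + by exists s => //; exists q => //; exists k.
  + exact: ball_sym.
  + move=> z qz; apply: eU; apply: le_ball (ltW ke) _ _.
    exact: ball_triangle aq qz.
- move=> C FC _ [x Cx <-]; apply: contrapT => nC.
  have : nbhs (P (t F) x : sigma_topology D) (~` C).
    by apply: open_nbhs_nbhs; split=> //; apply: closed_openC; exact: clF.
  move=> /nbhs_sigma[e e0 [l [lD lC]]].
  have [m mP] : exists m : nat, forall f, f \in l -> forall v, `|f v| <= m%:R * `|v|.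
    by apply: dual_seq_bounded => f /lD; exact: Ddual.
  have [k ke] := double_inv_lt e0.
  have k0 : 0 < (k.+1%:R^-1 : R) by rewrite invr_gt0.
  (* A functional bounded by [m] varies by less than [k.+1%:R^-1] on a ball of
     radius [del]. *)
  pose del : R := k.+1%:R^-1 / m.+1%:R.
  have del0 : 0 < del / 2 by rewrite !divr_gt0.
  have mdel : m%:R * del < k.+1%:R^-1.
    by rewrite /del mulrCA gtr_pMr// ltr_pdivrMr// mul1r ltr_nat.
  have ra : closure (\bigcup_(s in H F) range (P s)) (P (t F) x) by rewrite -rt; exists x.
  have [y [[s Hs sy] /= ay]] := ra _ (nbhsx_ballx _ _ del0).
  have [_ /(_ y sy)] := QP s; move=> /(_ _ (nbhsx_ballx y _ del0))[q [Qq /= yq]].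
  have : ball (P (t F) x) del q by rewrite (splitr del); exact: ball_triangle ay yq.
  rewrite -ball_normE /ball_ /= => aq.
  have close f : dual E f -> (forall v, `|f v| <= m%:R * `|v|) ->
      `|f (P (t F) x) - f q| < k.+1%:R^-1.
    move=> fd fm; rewrite -dualB//; apply: le_lt_trans (fm _) _.
    by apply: le_lt_trans mdel; rewrite ler_wpM2l// ltW.
  (* [l] itself avoids [C] around [q], so a fixed witness [l'] exists. *)
  have [|l' [l'D l'm l'C] l'w] := wP C q m k.
    exists l; split=> // z Cz lz; apply: (lC z) Cz => f fl.
    rewrite -(subrK (f q) (f z)) -addrA; apply: le_lt_trans (ler_normD _ _) _.
    apply: lt_trans ke; apply: ltrD; first exact: lz.
    by rewrite distrC; apply: close; [exact/Ddual/lD|exact: mP].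
  apply: (l'C x Cx) => f fl'.
  have -> : f x = f (P (t F) x).
    have /(congr1 (fun g => g x)) /= <- := l'w f fl'.
    have /(congr1 (fun g => g (P (t F) x))) /= <- := l'w f fl'.
    rewrite -P_le//; apply: tH; exact: HW FC Hs Qq.
  by apply: close; [exact/Ddual/l'D|exact: l'm].
Qed.

End SkeletonToSokolov.

(** * Projections defined by a pair of countable sets *)

Section RationalSubspaces.
Context {R : realType} {V : lmodType R} (p : V -> R).
Hypothesis pD : forall u v, p (u + v) <= p u + p v.
Hypothesis pZ : forall a u, p (a *: u) = `|a| * p u.

Definition seminorm_closure (A : set V) : set V :=
  [set v | forall e : R, 0 < e -> exists2 a, A a & p (v - a) < e].

(** Rational approximation of the scalar [c]:
    [c *: u + v - (q *: a + b) = (c - q) *: u + q *: (u - a) + (v - b)]. *)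
Lemma seminorm_closure_linear (A : set V) (c : R) u v :
  (forall (q : rat) a b, A a -> A b -> A (ratr q *: a + b)) ->
  seminorm_closure A u -> seminorm_closure A v ->
  seminorm_closure A (c *: u + v).
Proof.
move=> AQ Au Av e e0.
have p0 : p 0 = 0 by rewrite -(scale0r 0) pZ normr0 mul0r.
have p_ge0 w : 0 <= p w.
  have := pD w (- w); rewrite subrr p0 -scaleN1r pZ normrN1 mul1r.
  by rewrite -mulr2n pmulrn_lge0.
have e3 : 0 < e / 3 by rewrite divr_gt0.
have pu : 0 < p u + 1 by rewrite ltr_wpDl.
have c1 : 0 < `|c| + 1 by rewrite ltr_wpDl.
have [a Aa ua] := Au _ (divr_gt0 e3 c1).
have [b Ab vb] := Av _ e3.
pose del := Num.min 1 (e / 3 / (p u + 1)).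
have del0 : 0 < del by rewrite lt_min ltr01 divr_gt0.
have /rat_in_itvoo[q /itvP qc] : c < c + del by rewrite ltrDl.
exists (ratr q *: a + b); first exact: AQ.
have cq : `|c - ratr q| < del.
  by rewrite distrC ger0_norm ?subr_ge0 ?qc// ltrBlDl qc.
have [cq1 cq2] : `|c - ratr q| < 1 /\ `|c - ratr q| < e / 3 / (p u + 1).
  by move: cq; rewrite lt_min => /andP.
have -> : c *: u + v - (ratr q *: a + b) =
    (c - ratr q) *: u + ratr q *: (u - a) + (v - b).
  rewrite opprD addrACA; congr (_ + _).
  by rewrite scalerBl scalerBr addrA subrK.
have -> : e = e / 3 + e / 3 + e / 3 by lra.
apply: le_lt_trans (pD _ _) _; apply: ltrD vb.
apply: le_lt_trans (pD _ _) _; rewrite !pZ; apply: ltrD.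
  move: cq2; rewrite ltr_pdivlMr//; apply: le_lt_trans.
  by rewrite ler_wpM2l// lerDl.
move: ua; rewrite ltr_pdivlMr// mulrC; apply: le_lt_trans.
rewrite ler_wpM2r//; rewrite -[X in `|X|](subKr c) (le_trans (ler_normB _ _))//.
by rewrite lerD2l ltW.
Qed.

End RationalSubspaces.

(** Finite-dimensional duality: a functional that vanishes on the common kernel
    of [W] agrees on any finite set with a member of [W].  Induction on the
    finite set: if some [g1] in [W] has [g1 x = 1], project the other points
    along [x] onto the kernel of [g1], interpolate there, and correct the value
    at [x] by a multiple of [g1]. *)
Lemma interpolation (R : realType) (E : lmodType R) (W : set (E -> R)) :
  (forall f, W f -> scalar f) -> W (fun=> 0) ->
  (forall (a : R) f g, W f -> W g -> W (fun x => a * f x + g x)) ->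
  forall (phi : E -> R), scalar phi ->
  (forall x, (forall f, W f -> f x = 0) -> phi x = 0) ->
  forall l : seq E, exists2 g, W g & forall x, x \in l -> g x = phi x.
Proof.
move=> Wlin W0 WD phi philin phi0 l.
have [n] := ubnP (size l); elim: n l phi philin phi0 => // n IH.
move=> [|x l] phi philin phi0 /= ln; first by exists (fun=> 0).
have [[g0 Wg0 g0x]|nog] := pselect (exists2 g, W g & g x <> 0); last first.
  have Wx f : W f -> f x = 0.
    by move=> Wf; apply: contrapT => fx; apply: nog; exists f.
  have [g Wg gl] := IH l phi philin phi0 ln.
  exists g => // y; rewrite inE => /orP[/eqP ->|/gl//].
  by rewrite Wx// phi0.
have /eqP g0x' := g0x.
pose g1 y := (g0 x)^-1 * g0 y + 0.
have Wg1 : W g1 by exact: (WD _ _ (fun=> 0)).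
have g1x : g1 x = 1 by rewrite /g1 addr0 mulVf.
pose proj y := - g1 y *: x + y.
have g1lin := Wlin _ Wg1.
pose psi y := - phi x * g1 y + phi y.
have psilin : scalar psi.
  move=> a y z; rewrite /psi g1lin philin; ring.
have psi0 y : (forall f, W f -> f y = 0) -> psi y = 0.
  by move=> Wy; rewrite /psi (Wy _ Wg1) (phi0 y Wy) mulr0 addr0.
have [|g Wg gl] := IH (map proj l) psi psilin psi0; first by rewrite size_map.
have psix : psi x = 0 by rewrite /psi g1x mulr1 addNr.
exists (fun y => phi x * g1 y + (- g x * g1 y + g y)).
  by apply: (WD) => //; apply: WD.
move=> y; rewrite inE => /orP[/eqP ->|yl].
  by rewrite g1x !mulr1 addNr addr0.
have gy : g (proj y) = psi (proj y) by apply: gl; exact: map_f.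
have gp : g (proj y) = - g1 y * g x + g y by exact: Wlin.
have psip : psi (proj y) = - g1 y * psi x + psi y by exact: psilin.
have psiy : psi y = - phi x * g1 y + phi y by [].
rewrite psix mulr0 add0r in psip; lra.
Qed.

Definition annihilator (R : realType) (E : normedModType R) (X : set (E -> R)) : set E :=
  [set k | forall f, X f -> f k = 0].

Lemma closureP (R : realType) (E : normedModType R) (A : set E) x :
  closure A x <-> seminorm_closure Num.norm A x.
Proof.
split=> [Ax e e0|Ax U /nbhs_ballP[e e0 eU]].
  have [a [Aa]] := Ax _ (nbhsx_ballx x e e0).
  by rewrite -ball_normE /ball_ /= => xa; exists a.
have [a Aa xa] := Ax e e0; exists a; split=> //; apply: eU.
by rewrite -ball_normE.
Qed.

Section Pair.
Context {R : realType} {E : completeNormedModType R}.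
Variables (D : set (E -> R)) (EM : set E) (DM : set (E -> R)) (c : R).
Hypothesis Dcc : weak_star_countably_closed D.
Hypothesis Ddual : D `<=` dual E.
Hypothesis c0 : 0 <= c.
Hypothesis DMD : DM `<=` D.
Hypothesis DMcountable : countable DM.
Hypothesis DM0 : DM (fun=> 0).
Hypothesis DMQ : forall (q : rat) f g, DM f -> DM g -> DM (fun x => ratr q * f x + g x).

(** A bipolar theorem: [phi] lies in the weak* closure of the countable set
    [DM], hence in [D].  The pointwise closure [W] of [DM] is a real linear
    space, so [phi] agrees with a member of [W] on every finite set. *)
Lemma dual_vanish_annihilator phi : dual E phi ->
  (forall k, annihilator DM k -> phi k = 0) -> D phi.
Proof.
move=> phid phi0; apply: Dcc DMcountable DMD _ _; split=> //.
pose p (l : seq E) (f : E -> R) : R := \sum_(x <- l) `|f x|.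
have pD l f g : p l (f + g) <= p l f + p l g.
  by rewrite /p -big_split; apply: ler_sum => x _; exact: ler_normD.
have pZ l a f : p l (a *: f) = `|a| * p l f.
  by rewrite /p mulr_sumr; apply: eq_bigr => x _; rewrite normrM.
(* Sums of absolute values over finite sets are the seminorms of pointwise
   convergence. *)
pose W := [set f : E -> R | scalar f /\ forall l, seminorm_closure (p l) DM f].
have DMW f : DM f -> W f.
  move=> Df; split; first by have [] := Ddual (DMD Df).
  move=> l e e0; exists f => //; rewrite subrr /p big1// => x _.
  by rewrite normr0.
have Wlin (a : R) f g : W f -> W g -> W (fun x => a * f x + g x).
  move=> [flin fW] [glin gW]; split=> [b x y|l].
    by rewrite flin glin; ring.
  exact: (seminorm_closure_linear (pD l) (pZ l) a DMQ).
have phiW x : (forall f, W f -> f x = 0) -> phi x = 0.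
  by move=> Wx; apply: phi0 => f /DMW; exact: Wx.
move=> U /nbhs_ptws[e e0 [l lU]].
have [g [glin gW] gl] :=
  @interpolation R E W (fun f => @proj1 _ _) (DMW _ DM0) Wlin phi (proj1 phid) phiW l.
have [h DMh gh] := gW l e e0; exists h; split=> //; apply: lU => x xl.
rewrite -gl// distrC; apply: le_lt_trans gh.
by rewrite /p (big_rem x)//= lerDl sumr_ge0.
Qed.

Hypothesis EM0 : EM 0.
Hypothesis EMQ : forall (q : rat) x y, EM x -> EM y -> EM (ratr q *: x + y).
Hypothesis DMnorming : forall x, EM x -> exists f, [/\ DM f,
  forall v, `|f v| <= `|v| & `|x| <= c * `|f x|].
Hypothesis EMseparates : forall phi, D phi ->
  (forall k, annihilator DM k -> phi k = 0) ->
  (forall x, EM x -> phi x = 0) -> forall x, phi x = 0.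

Let closure_EM_linear (a : R) x y :
  closure EM x -> closure EM y -> closure EM (a *: x + y).
Proof.
move=> /closureP EMx /closureP EMy; apply/closureP.
apply: seminorm_closure_linear => //; first exact: ler_normD.
exact: normrZ.
Qed.

Let annihilator_linear (a : R) x y :
  annihilator DM x -> annihilator DM y -> annihilator DM (a *: x + y).
Proof.
move=> Kx Ky f Df; have [flin _] := Ddual (DMD Df).
by rewrite flin Kx// Ky// mulr0 addr0.
Qed.

(** A functional norming [x] does not see [k]; hence [closure EM] meets the
    annihilator trivially, and the projection along it is bounded by [c]. *)
Let closure_EM_norm x k : closure EM x -> annihilator DM k -> `|x| <= c * `|x + k|.
Proof.
move=> /closureP EMx Kk; apply/ler_addgt0Pr => e e0.
have c1 : 0 < 1 + c by rewrite ltr_pwDl.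
have [y EMy xy] := EMx _ (divr_gt0 e0 c1).
have [f [Df f1 fy]] := DMnorming EMy.
have yk : `|y| <= c * `|y + k|.
  apply: (le_trans fy); rewrite ler_wpM2l//.
  have -> : f y = f (y + k).
    have [flin _] := Ddual (DMD Df).
    by have := flin 1 y k; rewrite scale1r mul1r (Kk f Df) addr0 => ->.
  exact: f1.
have : `|y + k| <= `|x + k| + e / (1 + c).
  have -> : y + k = (x + k) - (x - y) by rewrite opprB [RHS]addrC addrA subrK.
  by apply: le_trans (ler_normB _ _) _; rewrite lerD2l ltW.
move=> /(ler_wpM2l c0) /(le_trans yk) {}yk.
have -> : `|x| = `|x - y + y| by rewrite subrK.
apply: le_trans (ler_normD _ _) _.
have -> : e = e / (1 + c) + c * (e / (1 + c)) by field; rewrite gt_eqF.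
have := ltW xy; move: yk; set u := e / _; lra.
Qed.

(** Otherwise Hahn-Banach yields a nonzero [phi] that vanishes on [EM] and on
    the annihilator; [phi] belongs to [D] by the bipolar argument, against the
    hypothesis that [EM] separates such functionals. *)
Let sum_dense x (e : R) : 0 < e -> exists y k,
  [/\ closure EM y, annihilator DM k & `|x - (y + k)| < e].
Proof.
move=> e0; apply: contrapT => nyk.
pose S := [set z | exists y k, [/\ closure EM y, annihilator DM k & z = y + k]].
have clEM0 : closure EM 0 by exact: subset_closure.
have K0 : annihilator DM 0.
  by move=> f Df; exact/dual0/Ddual/DMD.
have [|a _ _ [y [k [EMy Kk ->]]] [z [l [EMz Kl ->]]]||z [y [k [EMy Kk ->]]]|
    phi phid [phix phiS]] :=
    @dual_separates _ _ S x e.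
- by exists 0, 0; rewrite addr0.
- exists (a *: y + z), (a *: k + l).
  split; [exact: closure_EM_linear|exact: annihilator_linear|].
  by rewrite scalerDr addrACA.
- by [].
- by rewrite leNgt; apply/negP => xe; apply: nyk; exists y, k.
have phiK k : annihilator DM k -> phi k = 0.
  by move=> Kk; apply: phiS; exists 0, k; rewrite add0r.
have := EMseparates (dual_vanish_annihilator phid phiK) phiK.
have phiEM y : EM y -> phi y = 0.
  by move=> EMy; apply: phiS; exists y, 0; rewrite addr0; split=> //;
    exact: subset_closure.
by move=> /(_ phiEM x); rewrite phix => /eqP; rewrite oner_eq0.
Qed.

(** The sum is closed: by [closure_EM_norm] the first components of a convergent
    sequence of sums form a Cauchy sequence. *)
Let decompose x : exists2 y, closure EM y & annihilator DM (x - y).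
Proof.
have /choice[y_ yP] (n : nat) : exists y, closure EM y /\
    exists2 k, annihilator DM k & `|x - (y + k)| < n.+1%:R^-1.
  have [|y [k [EMy Kk xyk]]] := @sum_dense x n.+1%:R^-1; first by rewrite invr_gt0.
  by exists y; split=> //; exists k.
have inv_small (e : R) : 0 < e -> exists N : nat, forall n, (N <= n)%N -> n.+1%:R^-1 < e.
  move=> e0; exists (Num.truncn e^-1) => n Nn.
  rewrite -[ltRHS]invrK ltf_pV2 ?posrE ?invr_gt0//.
  by apply: lt_le_trans (truncnS_gt _) _; rewrite ler_nat ltnS.
have ycauchy : cauchy_ex (y_ @ \oo).
  move=> e e0; have c2 : 0 < 2 * (1 + c) by rewrite mulr_gt0// ltr_pwDl.
  have [w w0 we] : exists2 w, 0 < w & w * (2 * (1 + c)) = e.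
    by exists (e / (2 * (1 + c))); rewrite ?divr_gt0// divfK// gt_eqF.
  have [N NP] := inv_small _ w0; exists (y_ N); exists N => // n /= Nn.
  rewrite -ball_normE /ball_ /=.
  have [EMn [kn Kn xn]] := yP n; have [EMN [kN KN xN]] := yP N.
  have EMd : closure EM (y_ N - y_ n).
    by rewrite addrC -scaleN1r; exact: closure_EM_linear.
  have Kd : annihilator DM (kN - kn).
    by rewrite addrC -scaleN1r; exact: annihilator_linear.
  apply: le_lt_trans (closure_EM_norm EMd Kd) _.
  have -> : y_ N - y_ n + (kN - kn) = (x - (y_ n + kn)) - (x - (y_ N + kN)).
    by rewrite opprB [RHS]addrC subrKA opprD addrACA.
  have xx := le_trans (ler_normB (x - (y_ n + kn)) (x - (y_ N + kN))) (ltW (ltrD xn xN)).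
  apply: le_lt_trans (ler_wpM2l c0 xx) _.
  have hn := NP _ Nn; have hN := NP _ (leqnn N).
  have ce : c * (2 * w) < e by rewrite -we; lra.
  apply: le_lt_trans ce; rewrite ler_wpM2l// mulrDl mul1r.
  by rewrite ltW// ltrD.
have /cauchy_cvgP ycvg : cauchy (y_ @ \oo) by exact: cauchy_exP.
set y := lim (y_ @ \oo) in ycvg.
exists y.
  apply: (closed_cvg _ (@closed_closure _ EM) _ _ ycvg).
  by apply: nearW => n; have [] := yP n.
move=> f Df; have fd := Ddual (DMD Df).
have [m mP] := dual_bounded fd.
apply/eqP; rewrite -normr_le0; apply/ler_addgt0Pr => e e0; rewrite add0r.
have m2 : 0 < 2 * (m%:R + 1) :> R by rewrite mulr_gt0// ltr_wpDl.
have [w w0 we] : exists2 w, 0 < w & w * (2 * (m%:R + 1)) = e.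
  by exists (e / (2 * (m%:R + 1))); rewrite ?divr_gt0// divfK// gt_eqF.
have [N NP] := inv_small _ w0.
have /cvgrPdist_lt/(_ _ w0) [M _ MP] := ycvg.
pose n := maxn N M.
have hn := NP n (leq_maxl _ _); have /= hy := MP n (leq_maxr _ _).
have [_ [k Kk xk]] := yP n.
have -> : f (x - y) = f (x - (y_ n + k)) - f (y - y_ n).
  have eqk : x - (y_ n + k) - (y - y_ n) = x - y - k.
    have -> : x - (y_ n + k) = x - y_ n - k by rewrite opprD addrA.
    by rewrite opprB addrAC subrKA.
  by rewrite -dualB// eqk (dualB (x - y) k fd) (Kk f Df) subr0.
apply: le_trans (ler_normB _ _) _.
have h1 := mP (x - (y_ n + k)); have h2 := mP (y - y_ n).
have h3 : m%:R * `|x - (y_ n + k)| <= m%:R * w.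
  by rewrite ler_wpM2l// ltW// (lt_trans xk).
have h4 : m%:R * `|y - y_ n| <= m%:R * w by rewrite ler_wpM2l// ltW.
have h5 : m%:R * w + m%:R * w <= e by rewrite -we; lra.
apply: le_trans h5; apply: lerD; first exact: le_trans h1 h3.
exact: le_trans h2 h4.
Qed.

Lemma projection_of_pair : exists P : {linear E -> E},
  [/\ forall x, `|P x| <= c * `|x|, range P = closure EM,
      forall x, closure EM x -> P x = x,
      forall x f, DM f -> f (P x) = f x &
      forall x, annihilator DM x -> P x = 0].
Proof.
have uniq x y z : closure EM y -> closure EM z -> annihilator DM (x - y) ->
    annihilator DM (x - z) -> y = z.
  move=> EMy EMz Ky Kz; apply/eqP; rewrite -subr_eq0 -normr_le0.
  have EMd : closure EM (y - z) by rewrite addrC -scaleN1r; exact: closure_EM_linear.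
  have Kd : annihilator DM (- 1 *: (x - z) + (x - y)) by exact: annihilator_linear.
  have := closure_EM_norm EMd Kd.
  suff -> : y - z + (- 1 *: (x - z) + (x - y)) = 0 by rewrite normr0 mulr0.
  by rewrite scaleN1r opprB !subrKA subrr.
have /choice[P PP] x : exists y, closure EM y /\ annihilator DM (x - y).
  by have [y] := decompose x; exists y.
have Plin : linear P.
  move=> a x y; apply: (uniq (a *: x + y)).
  - by have [] := PP (a *: x + y).
  - by apply: closure_EM_linear; [case: (PP x)|case: (PP y)].
  - by have [] := PP (a *: x + y).
  - have -> : a *: x + y - (a *: P x + P y) = a *: (x - P x) + (y - P y).
      by rewrite opprD addrACA scalerBr.
    by apply: annihilator_linear; [case: (PP x)|case: (PP y)].
have Pfix x : closure EM x -> P x = x.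
  move=> EMx; have [EMP KP] := PP x; apply: (uniq x) => //.
  by rewrite subrr => f Df; exact/dual0/Ddual/DMD.
pose L : {linear E -> E} := HB.pack P (GRing.isLinear.Build R E E *:%R P Plin).
exists L; split=> /=.
- move=> x; have [EMP KP] := PP x.
  by have := closure_EM_norm EMP KP; rewrite addrC subrK.
- apply/seteqP; split=> [_ [x _ <-]|x EMx]; first by have [] := PP x.
  by exists x => //; exact: Pfix.
- exact: Pfix.
- move=> x f Df; have [_ /(_ f Df)] := PP x.
  by rewrite (dualB _ _ (Ddual (DMD Df))) => /eqP; rewrite subr_eq0 => /eqP.
- move=> x Kx; have [EMP KP] := PP x; apply: (uniq x) => //.
    exact: subset_closure.
  by rewrite subr0.
Qed.

End Pair.

(** * From the Sokolov property to a projectional skeleton *)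

Section SetFamily.
Context {T : Type} (K : set (set T)).

(** A copy of [set_type K] that carries the inclusion order. *)
Definition set_family : Type := set_type K.
HB.instance Definition _ := Choice.on set_family.

Let family_le (A B : set_family) := `[< val A `<=` val B >].

Let family_le_refl : reflexive family_le.
Proof. by move=> A; apply/asboolP. Qed.

Let family_le_anti : antisymmetric family_le.
Proof.
move=> A B /andP[/asboolP AB /asboolP BA].
by apply: val_inj; apply/seteqP.
Qed.

Let family_le_trans : transitive family_le.
Proof.
by move=> B A C /asboolP AB /asboolP BC; apply/asboolP; exact: subset_trans BC.
Qed.

HB.instance Definition _ := Order.Le_isPOrder.Build set_display set_family
  family_le_refl family_le_anti family_le_trans.

Lemma set_familyP (A B : set_family) : reflect (val A `<=` val B) (A <= B)%O.
Proof. exact: asboolP. Qed.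

End SetFamily.

Section SokolovToSkeleton.
Context {R : realType} {E : completeNormedModType R}.
Variable D : set (E -> R).
Hypothesis hD : dual_subspace D.
Hypothesis Dcc : weak_star_countably_closed D.

Let Ddual : D `<=` dual E. Proof. by case: hD. Qed.
Let D0 : D (fun=> 0). Proof. by case: hD. Qed.

Lemma sigma_continuous f : D f -> continuous (f : sigma_topology D -> R).
Proof.
move=> Df x U /nbhs_ballP[e e0 eU]; apply/nbhs_sigma; exists e => //.
exists [:: f]; split=> [g|y /(_ f (mem_head _ _)) yx].
  by rewrite /= inE => /eqP ->.
by apply: eU; rewrite -ball_normE /ball_ /= distrC.
Qed.

(** A retraction that preserves these sets fixes the values of every functional
    in [X]. *)
Definition half_spaces (X : set (E -> R)) : set (set (sigma_topology D)) :=
  \bigcup_(f in X) \bigcup_(q in [set: rat])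
    [set [set x | ratr q <= f x]; [set x | f x <= ratr q]].

Lemma half_spaces_closed (X : set (E -> R)) : countable X -> X `<=` D ->
  countable_closed_family (half_spaces X).
Proof.
move=> cX XD; split.
  apply: bigcup_countable => // f _; apply: bigcup_countable => // q _.
  exact: finite_set_countable (finite_set2 _ _).
move=> C [f /XD Df [q _ [->|->]]].
  exact: preimage_closed (fun x _ => @sigma_continuous f Df x) (@closed_ge _ (ratr q)).
exact: preimage_closed (fun x _ => @sigma_continuous f Df x) (@closed_le _ (ratr q)).
Qed.

Lemma half_spaces_invariant (X : set (E -> R)) (r : E -> E) :
  (forall C, half_spaces X C -> r @` C `<=` C) ->
  forall f, X f -> forall x, f (r x) = f x.
Proof.
move=> rC f Xf x; apply/eqP; rewrite eq_le; apply/andP; split.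
  rewrite leNgt; apply/negP => /rat_in_itvoo[q /itvP fq].
  have : r x \in [set y | f y <= ratr q].
    apply/mem_set/(rC [set y | f y <= ratr q]); last by exists x => //=; rewrite fq.
    by exists f => //; exists q => //; right.
  by move=> /set_mem /=; rewrite leNgt fq.
rewrite leNgt; apply/negP => /rat_in_itvoo[q /itvP fq].
have : r x \in [set y | ratr q <= f y].
  apply/mem_set/(rC [set y | ratr q <= f y]); last by exists x => //=; rewrite fq.
  by exists f => //; exists q => //; left.
by move=> /set_mem /=; rewrite leNgt fq.
Qed.

Variables (c : R) (nf : E -> (E -> R)).
Hypothesis c0 : 0 <= c.
Hypothesis nfP : forall x, [/\ D (nf x), forall v, `|nf x v| <= `|v| &
  `|x| <= c * `|nf x x|].
Variables (r : set (set (sigma_topology D)) -> sigma_topology D -> sigma_topology D)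
  (N : set (set (sigma_topology D)) -> set (set (sigma_topology D))).
Hypothesis Nomega : omega_monotone N.
Hypothesis rN : forall F, countable_closed_family F ->
  [/\ continuous (r F), r F \o r F = r F, external_network (N F) (range (r F)) &
      forall C, F C -> r F @` C `<=` C].

Let zero : E * (E -> R) := (0, fun=> 0).

(** The operations under which a model is closed.  They provide, in this order:
    rational combinations of vectors and of functionals, a functional norming a
    given vector, and a point of every network member attached to the
    half-spaces of finitely many functionals.  The last clause is guarded, since
    countability of the network is only known for countable families of closed
    sets. *)
Let pair_op (s : seq (E * (E -> R))) : set (E * (E -> R)) :=
  let u := nth zero s 0 in let v := nth zero s 1 in
  \bigcup_(q in [set: rat])
    [set (ratr q *: u.1 + v.1, fun=> 0); (0, fun x => ratr q * u.2 x + v.2 x)] `|`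
  [set (0, nf u.1)] `|`
  [set (xget 0 B, fun=> 0) | B in [set B | N (half_spaces [set` map snd s]) B /\
     countable_closed_family (half_spaces [set` map snd s])]].

Let countable_pair_op s : countable (pair_op s).
Proof.
apply: countable_setU; first apply: countable_setU.
- apply: bigcup_countable => // q _.
  exact: finite_set_countable (finite_set2 _ _).
- exact: countable1.
- apply: sub_countable (card_image_le _ _) _.
  have [cl|ncl] := pselect (countable_closed_family (half_spaces [set` map snd s])).
    have [cN _ _] := Nomega.
    by apply: sub_countable (cN _ cl); apply: subset_card_le => B [].
  by apply: sub_countable (countable0 _); apply: subset_card_le => B [].
Qed.

(** The vectors and the functionals of a model are the coordinates of one set of
    pairs, so that a single hull produces both. *)
Definition model : set (set (E * (E -> R))) :=
  [set M | [/\ countable M, op_closed pair_op M & snd @` M `<=` D]].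

Let hull_model B : countable B -> snd @` B `<=` D -> model (hull pair_op B).
Proof.
move=> cB BD; split; [exact: countable_hull|exact: hull_closed|].
suff : hull pair_op B `<=` [set u | D u.2] by move=> sub _ [u /sub Du <-].
apply: hull_min => [s sD u|u Bu]; last by apply: BD; exists u.
have Dnth i : D (nth zero s i).2.
  have [si|si] := leqP (size s) i; first by rewrite nth_default.
  by apply: sD; exact: mem_nth.
have [_ _ Dlin] := hD.
move=> [[[q _ [->|->]]|->]|[B' _ <-]] //=; first exact: Dlin.
by have [] := nfP (nth zero s 0).1.
Qed.

Section Model.
Variable M : set (E * (E -> R)).
Hypothesis hM : model M.

Let cM : countable M. Proof. by case: hM. Qed.
Let clM : op_closed pair_op M. Proof. by case: hM. Qed.
Let MD : snd @` M `<=` D. Proof. by case: hM. Qed.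

Let snd_countable : countable (snd @` M).
Proof. exact: sub_countable (card_image_le _ _) cM. Qed.

Let M0 : M zero.
Proof.
apply: (clM (s := [::])) => //; left; left; exists 0 => //; left.
by rewrite /= scaler0 addr0.
Qed.

Let fst_rational (q : rat) x y :
  (fst @` M) x -> (fst @` M) y -> (fst @` M) (ratr q *: x + y).
Proof.
move=> [u Mu <-] [v Mv <-]; exists (ratr q *: u.1 + v.1, fun=> 0) => //.
apply: (clM (s := [:: u; v])).
  by move=> w; rewrite /= !inE => /orP[] /eqP ->.
by left; left; exists q => //; left.
Qed.

Let snd_rational (q : rat) f g :
  (snd @` M) f -> (snd @` M) g -> (snd @` M) (fun x => ratr q * f x + g x).
Proof.
move=> [u Mu <-] [v Mv <-]; exists (0, fun x => ratr q * u.2 x + v.2 x) => //.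
apply: (clM (s := [:: u; v])).
  by move=> w; rewrite /= !inE => /orP[] /eqP ->.
by left; left; exists q => //; right.
Qed.

Let snd_norming x : (fst @` M) x -> exists f, [/\ (snd @` M) f,
  forall v, `|f v| <= `|v| & `|x| <= c * `|f x|].
Proof.
move=> [u Mu <-]; have [_ nf1 nfx] := nfP u.1; exists (nf u.1); split=> //.
exists (0, nf u.1) => //; apply: (clM (s := [:: u])); last by left; right.
by move=> w; rewrite /= !inE => /eqP ->.
Qed.

(** By omega-monotonicity the network of the whole countable family of
    half-spaces is the union of the networks attached to finitely many
    functionals, whose members are hit by the closure property of [M]. *)
Let network_in_model B : N (half_spaces (snd @` M)) B -> (fst @` M) (xget 0 B).
Proof.
have [h hM'] := countable_enum cM (ex_intro _ _ M0).
pose l n := map h (iota 0 n.+1).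
pose X n : set (E -> R) := [set` map snd (l n)].
have Mh n : M (h n) by rewrite -hM'; exists n.
have lM n : [set` l n] `<=` M by move=> _ /mapP[i _ ->].
have XD n : X n `<=` D.
  by move=> f /mapP[u /lM Mu ->]; apply: MD; exists u.
have XM : snd @` M = \bigcup_n X n.
  apply/seteqP; split=> [_ [u Mu <-]|f [n _ /mapP[u /lM Mu ->]]]; last by exists u.
  move: Mu; rewrite -{1}hM' => -[n _ <-]; exists n => //.
  by apply: map_f; apply: map_f; rewrite mem_iota add0n ltnSn.
have XS n : X n `<=` X n.+1.
  move=> f /mapP[_ /mapP[i + ->] ->]; rewrite mem_iota => /andP[_ i_n].
  by apply: map_f; apply: map_f; rewrite mem_iota (leq_trans i_n).
have clX n : countable_closed_family (half_spaces (X n)).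
  apply: half_spaces_closed; last exact: XD.
  by apply: finite_set_countable; exact: finite_seq.
have [_ _ Ncup] := Nomega.
have -> : half_spaces (snd @` M) = \bigcup_n half_spaces (X n).
  by rewrite XM /half_spaces bigcup_bigcup.
rewrite Ncup//; last by move=> n; exact: bigcup_subset.
move=> [n _ NB]; exists (xget 0 B, fun=> 0) => //.
apply: (clM (s := l n)); first exact: lM.
by right; exists B => //; split; [exact: NB|exact: clX].
Qed.

(** The retraction [r F] for the half-spaces of [snd @` M] moves every point
    along the annihilator, so [phi] takes the same value at [x] and at [r F x].
    If that value is nonzero, some network member around [r F x] lies inside
    [phi != 0], and it contains a point of [fst @` M]. *)
Let fst_separates phi : D phi ->
  (forall k, annihilator (snd @` M) k -> phi k = 0) ->
  (forall x, (fst @` M) x -> phi x = 0) -> forall x, phi x = 0.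
Proof.
move=> Dphi phiK phiM x; apply: contrapT => /eqP phix.
have [_ _ netF rC] := rN (half_spaces_closed snd_countable MD).
set F := half_spaces (snd @` M) in netF rC.
have rphi : phi (r F x) = phi x.
  apply/eqP; rewrite -subr_eq0 -dualB; last exact: Ddual.
  apply/eqP/phiK => f Mf; rewrite dualB; last exact/Ddual/MD.
  by rewrite (half_spaces_invariant rC Mf) subrr.
pose U : set (sigma_topology D) := [set y | phi y != 0].
have oU : open U.
  exact: open_comp (fun y _ => @sigma_continuous phi Dphi y) (@open_neq _ 0).
have Ur : U (r F x) by rewrite /U /= rphi.
have [|B [NB Br BU]] := netF (r F x) _ U oU Ur; first by exists x.
have /BU : B (xget 0 B) by apply: xgetPex; exists (r F x).
by rewrite /U /= phiM ?eqxx//; exact: network_in_model.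
Qed.

Lemma model_bipolar phi : dual E phi ->
  (forall k, annihilator (snd @` M) k -> phi k = 0) -> D phi.
Proof.
apply: (dual_vanish_annihilator Dcc Ddual MD snd_countable) => //.
by exists zero.
Qed.

Lemma model_projection : exists P : {linear E -> E},
  [/\ forall x, `|P x| <= c * `|x|, range P = closure (fst @` M),
      forall x, closure (fst @` M) x -> P x = x,
      forall x f, (snd @` M) f -> f (P x) = f x &
      forall x, annihilator (snd @` M) x -> P x = 0].
Proof.
apply: (projection_of_pair Dcc Ddual c0 MD snd_countable) => //; by exists zero.
Qed.

End Model.

(** The models, ordered by inclusion, index the skeleton.  A larger model has a
    larger range and a smaller kernel, which gives compatibility; unions of
    increasing sequences of models are models, which gives suprema. *)
Lemma Sokolov_skeleton : induced_by_projectional_skeleton D.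
Proof.
pose G := set_family model.
have GP (M : G) : model (val M) by exact: set_valP.
have /choice[P PP] (M : G) := model_projection (GP M).
have Gex B : countable B -> snd @` B `<=` D -> exists M : G, B `<=` val M.
  move=> cB BD; exists (SigSub (mem_set (hull_model cB BD))).
  exact: sub_hull.
have Pcont M : continuous (P M).
  have [Pc _ _ _ _] := PP M.
  apply/linear_bounded_continuous/linear_boundedP.
  by near=> t => x; apply: (le_trans (Pc x)); rewrite ler_wpM2r//; near: t;
    exact: nbhs_pinfty_ge.
exists set_display, G, P; split; last first.
  apply/seteqP; split=> [f Df|_ [M _ [g [glin gcont] <-]]].
    have [||M fM] := Gex [set (0, f)]; [exact: countable1|by move=> _ [_ -> <-]|].
    have [_ _ _ PD _] := PP M.
    exists M => //; exists f; first exact: Ddual.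
    apply/funext => x /=; apply: PD; exists (0, f) => //; exact: fM.
  have [_ _ _ _ PK] := PP M.
  apply: (model_bipolar (GP M)).
    split=> [a x y|x]; first by rewrite /= linearP glin.
    by apply: continuous_comp; [exact: Pcont|exact: gcont].
  by move=> k /PK /= ->; exact: dual0 (conj glin gcont).
have Pidem M x : P M (P M x) = P M x.
  have [_ rP Pfix _ _] := PP M.
  by apply: Pfix; rewrite -rP; exists x.
split.
- move=> A B; have [||M ABM] := Gex (val A `|` val B).
  + have [cA _ _] := GP A; have [cB _ _] := GP B.
    exact: countable_setU.
  + have [_ _ AD] := GP A; have [_ _ BD] := GP B.
    by rewrite image_setU => f [/AD|/BD].
  + by exists M; split; apply/set_familyP => u Mu; apply: ABM; [left|right].
- by move=> M; apply/linear_bounded_continuous; exact: Pcont.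
- by move=> M; apply/funext => x /=; exact: Pidem.
- move=> M; have [_ -> _ _ _] := PP M; exists (fst @` val M).
    have [cM _ _] := GP M; exact: sub_countable (card_image_le _ _) cM.
  by split=> //; exact: subset_closure.
- apply/seteqP; split=> // x _.
  have [||M xM] := Gex [set (x, fun=> 0)]; [exact: countable1|by move=> _ [_ -> <-]|].
  have [_ rP _ _ _] := PP M; exists M => //; rewrite rP.
  by apply: subset_closure; exists (x, fun=> 0) => //; exact: xM.
- move=> A B /set_familyP AB.
  have [_ rA fA kA nA] := PP A; have [_ rB fB kB nB] := PP B.
  split; apply/funext => x /=.
    apply/eqP; rewrite -subr_eq0 -linearB; apply/eqP/nA => f [u Mu <-].
    have Bu : (snd @` val B) u.2 by exists u => //; exact: AB.
    have [_ _ BD] := GP B.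
    by rewrite dualB ?kB ?subrr//; exact/Ddual/BD.
  have cAB : closure (fst @` val A) `<=` closure (fst @` val B).
    by apply: closureS; exact: image_subset.
  by rewrite fB//; apply: cAB; rewrite -rA; exists x.
- move=> s sS.
  pose A n := val (s n).
  have AS n : A n `<=` A n.+1 by apply/set_familyP; exact: ltW.
  have Gt : model (\bigcup_n A n).
    split.
    + by apply: bigcup_countable => // n _; have [] := GP (s n).
    + by apply: op_closed_bigcup => // n; have [] := GP (s n).
    + by move=> _ [u [n _ Au] <-]; have [_ _] := GP (s n); apply; exists u.
  pose t : G := SigSub (mem_set Gt); exists t.
    split=> [_ [n _ <-]|M sM].
      by apply/set_familyP => u Au; exists n.
    by apply/set_familyP => u [n _]; apply/set_familyP; apply: sM; exists n.
  have [_ rt _ _ _] := PP t; rewrite rt.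
  apply/seteqP; split.
    apply: closureS => _ [u [n _ Au] <-]; exists n => //.
    by have [_ -> _ _ _] := PP (s n); apply: subset_closure; exists u.
  apply: (subset_trans (@closureS _ _ (closure (fst @` val t)) _)); last first.
    by rewrite -(closure_id _).1//; exact: closed_closure.
  move=> x [n _]; have [_ -> _ _ _] := PP (s n).
  by apply: closureS => _ [u Au <-]; exists u => //; exists n.
Unshelve. all: by end_near. Qed.

End SokolovToSkeleton.

Unset Implicit Arguments.

Theorem theorem1p5 (R : realType) (E : completeNormedModType R)
    (D : set (E -> R)) (hD : dual_subspace D) (hnorm : norming D) :
  induced_by_projectional_skeleton D <->
  weak_star_countably_closed D /\ monotonically_Sokolov (sigma_topology D).
Proof.
have [Ddual D0 _] := hD; split=> [[d [G [P [skP DP]]]]|[Dcc [r [N [Nomega rN]]]]].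
  rewrite DP in Ddual *; split; first exact: skeleton_dual_countably_closed.
  exact: skeleton_dual_Sokolov.
have [c c1 cD] := hnorm.
have /choice[nf nfP] := norming_functional D0 c1 cD.
have c0 : 0 <= c * 2 by rewrite mulr_ge0// (le_trans _ c1).
exact (Sokolov_skeleton hD Dcc c0 nfP Nomega rN).
Qed.
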